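(* Let $(G,\circ)$ be a finite group with identity $1$ such that $g\circ g=1$ for every $g\in G$, let $\varphi:G\to G$ be a map, and let $g\in G$. Write $g^{\otimes 2}=\varphi(g)$, $g^{\otimes 4}=\varphi^{(2)}(g)$, and let $p^\ast(g)$ be the period of $g$. (1) For a general $\varphi$, $g\in\ker\varphi$ if and only if $p^\ast(g)=1$. (2) If $g$ commutes with $g^{\otimes 2}$ and $1\in\ker\varphi$, then $g\in\ker\varphi^{(2)}\setminus\ker\varphi$ if and only if $p^\ast(g)=2$. (3) Let $\bigtriangleup=\{h\in G : h^{\ast 2}=h^{\otimes 4}\}$. If $g$ commutes with $g^{\otimes 2}$ and with $g^{\otimes 4}$ and $1\in\ker\varphi$, then $g\in\varphi^{-1}(\mathrm{Im}\,\varphi\cap\bigtriangleup)\setminus\ker\varphi$ if and only if $p^\ast(g)=3$.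
   Context: The map $\varphi$ is not assumed to be a homomorphism. $\varphi^{(k)}$ is the $k$-fold iterate of $\varphi$; $\ker\varphi=\{h\in G:\varphi(h)=1\}$ and $\ker\varphi^{(2)}=\{h\in G:\varphi(\varphi(h))=1\}$. Define $g_1\ast g_2=g_1\circ\varphi(g_2)$, with powers $g^{\ast 1}=g$, $g^{\ast(i+1)}=g^{\ast i}\ast g^{\ast i}$ for $i\ge 1$. The period of $g$ is $p^\ast(g)=\min\{i>1 : g^{\ast i}=g\}-1$, with the minimum of the empty set taken to be $\infty$. The notation $\otimes$ stands for a (possibly non-associative) multiplication on $G$, distributive over $\circ$, with $h\otimes h=\varphi(h)$; its powers are $h^{\otimes 2}=h\otimes h=\varphi(h)$ and $h^{\otimes 4}=h^{\otimes 2}\otimes h^{\otimes 2}=\varphi^{(2)}(h)$. The commutator is $[g,h]=(g\otimes h)\circ(h\otimes g)$, which equals $\varphi(g\circ h)\circ\varphi(g)\circ\varphi(h)$; the latter expression in terms of $\varphi$ is taken as the definition of $[g,h]$ here. One says that $g$ commutes with $h$ if $[g,h]=1$, i.e. if $\varphi(g\circ h)=\varphi(g)\circ\varphi(h)$. *)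

(* Defs.v *)
From HB Require Import structures.
From mathcomp Require Import all_boot all_fingroup.
From mathcomp Require Import boolp.
Set Implicit Arguments.
Unset Strict Implicit.
Unset Printing Implicit Defensive.

Local Open Scope group_scope.

Definition map_ker (gT : finGroupType) (phi : gT -> gT) : {set gT} :=
  [set h | phi h == 1].

Definition star (gT : finGroupType) (phi : gT -> gT) (g1 g2 : gT) : gT :=
  g1 * phi g2.

(* The powers are indexed from 1: star_pow phi g 1 = g, and for 1 <= i        *)
(* star_pow phi g i.+1 = star phi (star_pow phi g i) (star_pow phi g i).      *)
(* The value at i = 0 is junk and is never used.                              *)
Definition star_pow (gT : finGroupType) (phi : gT -> gT) (g : gT) (i : nat)
  : gT := iter i.-1 (fun x => star phi x x) g.

Definition star_return (gT : finGroupType) (phi : gT -> gT) (g : gT)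
  : pred nat := fun i => (1 < i)%N && (star_pow phi g i == g).

(* None stands for infinity, the minimum of the empty set.                    *)
Definition star_period (gT : finGroupType) (phi : gT -> gT) (g : gT)
  : option nat :=
  if pselect (exists i, star_return phi g i) is left ex
  then Some (ex_minn ex - 1)%N else None.

(* otimes2 phi h is h (x) h and otimes4 phi h is (h (x) h) (x) (h (x) h); the *)
(* product (x) itself only occurs on the diagonal, where it is phi.           *)
Definition otimes2 (gT : finGroupType) (phi : gT -> gT) (h : gT) : gT := phi h.

Definition otimes4 (gT : finGroupType) (phi : gT -> gT) (h : gT) : gT :=
  otimes2 phi (otimes2 phi h).

Definition phi_commutator (gT : finGroupType) (phi : gT -> gT) (g h : gT)
  : gT := phi (g * h) * phi g * phi h.

Definition phi_commutes (gT : finGroupType) (phi : gT -> gT) (g h : gT)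
  : Prop := phi_commutator phi g h = 1.

Definition triangle (gT : finGroupType) (phi : gT -> gT) : {set gT} :=
  [set h | star_pow phi h 2 == otimes4 phi h].

(* Main.v *)
Require Import Defs.
From mathcomp Require Import all_boot all_fingroup.
From mathcomp Require Import boolp.
Set Implicit Arguments.
Unset Strict Implicit.
Unset Printing Implicit Defensive.

Local Open Scope group_scope.

(** Write [a = phi g] and [b = phi a].  A group in which every square is
    trivial is abelian and every element is its own inverse, so [g] commuting
    with [h] means [phi (g * h) = phi g * phi h].  Hence the powers of [g]
    telescope: the second is [g * a]; if [g] commutes with [a], the third is
    [g * b], because [a] cancels; if [g] also commutes with [b], the fourth is
    [g * (b * (a * phi b))].  Each is [g] exactly when the factor after [g] is
    trivial, so the period is
    - 1 iff [a = 1];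
    - 2 iff [a != 1] and [b = 1];
    - 3 iff [a != 1], [b != 1] and [a * b = phi b], the last equation saying
      that [a] lies in the triangle.
    In the third case [b != 1] follows from the other two: if [b = 1] then
    [phi b = phi 1 = 1], and [a * b = phi b] would give [a = 1]. *)

Section ExponentTwo.

Variables (gT : finGroupType) (hG : forall x : gT, x * x = 1).
Implicit Types x y : gT.

Lemma exponent2_invg x : x^-1 = x.
Proof. by apply: (mulgI x); rewrite mulgV hG. Qed.

Lemma exponent2_mulgC x y : x * y = y * x.
Proof. by rewrite -[x * y]exponent2_invg invMg !exponent2_invg. Qed.

Lemma exponent2_mulKg x y : x * (x * y) = y.
Proof. by rewrite mulgA hG mul1g. Qed.

Lemma exponent2_mulg_eq1 x y : (x * y == 1) = (x == y).
Proof. by rewrite [RHS]eq_mulgV1 exponent2_invg. Qed.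

Lemma phi_commutesE (phi : gT -> gT) x y :
  phi_commutes phi x y -> phi (x * y) = phi x * phi y.
Proof.
rewrite /phi_commutes /phi_commutator -mulgA => /eqP.
by rewrite exponent2_mulg_eq1 => /eqP.
Qed.

End ExponentTwo.

Lemma mulg_eql (gT : finGroupType) (x y : gT) : (x * y == x) = (y == 1).
Proof. by rewrite -{2}[x]mulg1 (inj_eq (mulgI x)). Qed.

(** Replaces the minimum over an unbounded search by finitely many tests, which
    is the form in which the periods 1, 2 and 3 are computed. *)
Lemma star_periodP (gT : finGroupType) (phi : gT -> gT) (g : gT) n :
  star_period phi g = Some n.+1 <->
  star_pow phi g n.+2 = g /\
  (forall i, (i < n)%N -> star_pow phi g i.+2 != g).
Proof.
rewrite /star_period; case: pselect => [ex | nex]; last first.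
  by split=> // -[e _]; case: nex; exists n.+2; rewrite /star_return e eqxx.
case: ex_minnP => -[|[|m]] // /andP[_ /eqP em] min_m; rewrite subn1 /=.
split=> [[<-] | [en lt_n]].
  split=> // i lt_im; apply/negP => ei.
  by have := min_m i.+2; rewrite /star_return ei => /(_ isT); rewrite !ltnS leqNgt lt_im.
have := min_m n.+2; rewrite /star_return en eqxx => /(_ isT).
rewrite !ltnS leq_eqVlt => /predU1P[-> // | /lt_n].
by rewrite em eqxx.
Qed.

Section StarPowers.

Variables (gT : finGroupType) (hG : forall x : gT, x * x = 1).
Variables (phi : gT -> gT) (g : gT).

Lemma star_pow2 : star_pow phi g 2 = g * phi g.
Proof. by []. Qed.

Lemma star_pow3 :
  phi_commutes phi g (phi g) -> star_pow phi g 3 = g * phi (phi g).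
Proof.
move=> /(phi_commutesE hG) phiM.
rewrite /star_pow /= /star phiM.
by rewrite -mulgA exponent2_mulKg.
Qed.

Lemma star_pow4 :
    phi_commutes phi g (phi g) -> phi_commutes phi g (phi (phi g)) ->
  star_pow phi g 4 = g * (phi (phi g) * (phi g * phi (phi (phi g)))).
Proof.
move=> cg2 /(phi_commutesE hG) phiM.
have -> : star_pow phi g 4 = star phi (star_pow phi g 3) (star_pow phi g 3).
  by [].
by rewrite star_pow3 // /star phiM -mulgA.
Qed.

(** Since elements are their own inverses, cancelling the factor that follows
    [g] in the fourth power means [phi g * phi (phi g) = phi (phi (phi g))]:
    this is where the triangle comes from. *)
Lemma star_pow4_eq :
    phi_commutes phi g (phi g) -> phi_commutes phi g (phi (phi g)) ->
  (star_pow phi g 4 == g) = (phi g \in triangle phi).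
Proof.
move=> cg2 cg4; rewrite star_pow4 // mulg_eql mulgA.
by rewrite exponent2_mulg_eq1 // exponent2_mulgC // inE.
Qed.

End StarPowers.

Theorem theorem3p2 (gT : finGroupType) (hG : forall x : gT, x * x = 1)
    (phi : gT -> gT) (g : gT) :
  [/\ g \in map_ker phi <-> star_period phi g = Some 1%N,
      phi_commutes phi g (otimes2 phi g) ->
      1 \in map_ker phi ->
      (g \in map_ker (iter 2 phi) :\: map_ker phi
       <-> star_period phi g = Some 2%N)
    & phi_commutes phi g (otimes2 phi g) ->
      phi_commutes phi g (otimes4 phi g) ->
      1 \in map_ker phi ->
      (g \in phi @^-1: ((phi @: [set: gT]) :&: triangle phi) :\: map_ker phi
       <-> star_period phi g = Some 3%N)].
Proof.
rewrite /otimes4 /otimes2; split.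
- rewrite star_periodP star_pow2 inE -(mulg_eql g).
  by split=> [/eqP | [/eqP]].
- move=> cg2 _; rewrite star_periodP star_pow3 // !inE /=.
  split=> [/andP[nz_a /eqP->] | [/eqP]].
    by rewrite mulg1; split=> // -[|//] _; rewrite star_pow2 mulg_eql.
  rewrite mulg_eql => -> /(_ 0%N isT).
  by rewrite star_pow2 mulg_eql => ->.
move=> cg2 cg4; rewrite inE => /eqP phi1.
rewrite star_periodP in_setD in_set inE in_setI imset_f ?inE //=.
split=> [/andP[nz_a tri_a] | [/eqP pow4 nret]].
  split; first by apply/eqP; rewrite star_pow4_eq // inE.
  case=> [|[|//]] _; rewrite ?star_pow2 ?star_pow3 // mulg_eql //.
  (* The third power is the only case left: it cannot return to [g]. *)
  apply: contraNneq nz_a => b1.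
  by move: tri_a; rewrite /otimes4 /otimes2 star_pow2 b1 phi1 mulg1.
have /= := nret 0%N isT; rewrite star_pow2 mulg_eql => -> /=.
by move: pow4; rewrite star_pow4_eq // inE.
Qed.
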